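(* Let $d\ge1$, let $k_1,\dots,k_d$ and $n_1,\dots,n_d$ be positive integers with $n_i\ge k_i-1$ for all $i$. Then the maximum possible value of the saturation function $\operatorname{sat}(n_1,n_2,\dots,n_d,P,d)$ over all $d$-dimensional 0-1 matrices $P$ of dimensions $k_1\times k_2\times\dots\times k_d$ with at least one $1$ entry is $$\prod_{i=1}^d n_i-\prod_{i=1}^d (n_i-k_i+1).$$
   Context: A $d$-dimensional 0-1 matrix $M$ contains a $d$-dimensional 0-1 matrix $P$ if some submatrix of $M$ (obtained by selecting a set of indices in each coordinate, keeping the order) can be turned into $P$ by changing some number (possibly zero) of its ones to zeroes. $M$ is $P$-saturated if $M$ does not contain $P$, but changing any $0$ entry of $M$ to a $1$ yields a matrix containing $P$. $\operatorname{sat}(n_1,\dots,n_d,P,d)$ is the minimum number of ones in a $P$-saturated $d$-dimensional 0-1 matrix of dimensions $n_1\times\dots\times n_d$. *)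

(* Defs.v *)
From mathcomp Require Import all_boot.

Set Implicit Arguments.
Unset Strict Implicit.
Unset Printing Implicit Defensive.

Definition entry_index (d : nat) (n : 'I_d -> nat) :=
  {dffun forall i : 'I_d, 'I_(n i)}.

Definition matrix01 (d : nat) (n : 'I_d -> nat) :=
  {ffun entry_index n -> bool}.

Section Saturation.

Variable d : nat.
Implicit Types k n : 'I_d -> nat.

Definition ones n (M : matrix01 n) : nat := #|[set x | M x]|.

(* A choice of k_i indices out of n_i in each coordinate i, in the order in
   which they occur, is encoded as its increasing enumeration. *)
Definition selection k n := {dffun forall i : 'I_d, {ffun 'I_(k i) -> 'I_(n i)}}.

Definition increasing k n (f : selection k n) : bool :=
  [forall i, forall a : 'I_(k i), forall b : 'I_(k i),
     (a < b) ==> (f i a < f i b)].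

Definition submatrix k n (f : selection k n) (M : matrix01 n) : matrix01 k :=
  [ffun x : entry_index k => M [ffun i : 'I_d => f i (x i)]].

Definition contains k n (M : matrix01 n) (P : matrix01 k) : bool :=
  [exists f : selection k n,
     increasing f && [forall x, P x ==> submatrix f M x]].

Definition set_one n (M : matrix01 n) (x : entry_index n) : matrix01 n :=
  [ffun y => (y == x) || M y].

Definition saturated k n (P : matrix01 k) (M : matrix01 n) : bool :=
  ~~ contains M P &&
  [forall x, ~~ M x ==> contains (set_one M x) P].

(* The neutral value \prod_i n_i bounds every [ones M]; it is irrelevant as
   soon as a P-saturated matrix exists, see [sat_attained]. *)
Definition sat n k (P : matrix01 k) : nat :=
  \big[minn/(\prod_(i < d) n i)]_(M : matrix01 n | saturated P M) ones M.

Definition nonzero k (P : matrix01 k) : bool := [exists x, P x].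

Lemma sat_le n k (P : matrix01 k) (M : matrix01 n) :
  saturated P M -> sat n P <= ones M.
Proof.
move=> satM; rewrite /sat; elim: (index_enum _) (mem_index_enum M) => // M' s IHs.
rewrite inE big_cons => /predU1P[<-|/IHs leM]; first by rewrite satM geq_minl.
by case: ifP => // _; rewrite geq_min leM orbT.
Qed.

Lemma ones_le n (M : matrix01 n) : ones M <= \prod_(i < d) n i.
Proof.
rewrite (leq_trans (max_card _)) // card_dep_ffun foldrE big_map big_enum /=.
by under eq_bigr do rewrite card_ord.
Qed.

Lemma saturated_exists n k (P : matrix01 k) :
  nonzero P -> exists M : matrix01 n, saturated P M.
Proof.
case/existsP=> x0 Px0.
have nc0 : ~~ contains ([ffun=> false] : matrix01 n) P.
  apply/existsP => -[f /andP[_ /forallP/(_ x0)]].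
  by rewrite Px0 !ffunE.
case: (@arg_maxnP _ ([ffun=> false] : matrix01 n)
         (fun M => ~~ contains M P) (@ones n) nc0) => M ncM maxM.
exists M; rewrite /saturated ncM; apply/forallP=> x; apply/implyP=> nMx.
suff: ones M < ones (set_one M x) by apply: contraLR => /maxM; rewrite -leqNgt.
apply/proper_card/properP; split.
  by apply/subsetP=> y; rewrite !inE ffunE => ->; rewrite orbT.
by exists x; rewrite !inE ?ffunE ?eqxx.
Qed.

Lemma sat_attained n k (P : matrix01 k) :
  nonzero P -> exists2 M : matrix01 n, saturated P M & ones M = sat n P.
Proof.
move=> /(saturated_exists n)[M0 satM0].
case: (@arg_minnP _ M0 (saturated P) (@ones n) satM0) => M satM minM.
exists M => //; apply/eqP; rewrite eqn_leq sat_le // andbT /sat.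
elim/big_ind: _ => [|a b la lb|]; [exact: ones_le | by rewrite leq_min la lb|].
exact: minM.
Qed.

End Saturation.

(* Main.v *)
Require Import Defs.
From mathcomp Require Import all_boot zify.

Set Implicit Arguments.
Unset Strict Implicit.
Unset Printing Implicit Defensive.

(** Fix an entry [p] of the pattern.  A copy of the pattern has [p i] slices
    before and [k i - 1 - p i] slices after the image of [p] in direction [i],
    so it can place [p] only inside a box, [core p], with
    [\prod_i (n i + 1 - k i)] cells.  Let [frame p] be the matrix that is one
    exactly off this box; it has the required number of ones.

    If [P p] is one, then [frame p] is [P]-saturated whatever the other entries
    of [P] are ([frame_saturated]).  It avoids [P] because the image of [p]
    falls on a zero.  When a cell [x] of the box is switched on, send [p] to
    [x] and push the other slices against the faces of the big matrix: a slice
    before [p] goes to the very beginning, a slice after [p] to the very end.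
    These slices all miss the box, and an entry of [P] other than [p] lies in
    one of them, so it lands on a one of the frame.  This yields the upper bound for every nonzero [P].

    The bound is attained when [p] is the only one of [P]: there is a copy of
    [P] in [M] as soon as [M] has a one in [core p], and no other cell ever
    takes part in a copy, so [frame p] is the only saturated matrix
    ([saturated_single_frame]). *)

(** Successive values grow by at least one.  The inequality
    [b - a <= f b - f a] is written without subtraction, which truncates. *)
Lemma increasing_gap k n (f : 'I_k -> 'I_n) :
  (forall a b : 'I_k, a < b -> f a < f b) ->
  forall a b : 'I_k, a <= b -> f a + b <= f b + a.
Proof.
move=> f_incr a [b lt_b] /=; elim: b lt_b => [|b IHb] lt_b.
  rewrite leqn0 => /eqP a0.
  by rewrite (_ : a = Ordinal lt_b) //; apply: val_inj.
rewrite leq_eqVlt => /predU1P[eq_a|]; last rewrite ltnS => le_ab.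
  by rewrite (_ : Ordinal lt_b = a) ?eq_a //; apply: val_inj.
have := IHb (ltnW lt_b) le_ab.
have := f_incr (Ordinal (ltnW lt_b)) (Ordinal lt_b) (leqnn _).
lia.
Qed.

(** The gap from the first index to [a] and the one from [a] to the last. *)
Lemma increasing_range k n (f : 'I_k -> 'I_n) :
  (forall a b : 'I_k, a < b -> f a < f b) ->
  forall a : 'I_k, (a <= f a) && (f a + k <= n + a).
Proof.
move=> f_incr a; have k_gt0 : 0 < k by apply: leq_ltn_trans (ltn_ord a).
have lt_last : k.-1 < k by rewrite prednK.
have := increasing_gap f_incr (leq0n a : Ordinal k_gt0 <= a).
have le_last : a <= Ordinal lt_last by rewrite /= -ltnS prednK.
have := increasing_gap f_incr le_last.
have := ltn_ord (f (Ordinal lt_last)); rewrite /=; lia.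
Qed.

Lemma card_ord_itv n a b : b <= n -> #|[pred j : 'I_n | a <= j < b]| = b - a.
Proof.
move=> le_bn; rewrite -sum1_card -(big_mkord (fun j => a <= j < b) (fun=> 1)).
rewrite -[RHS]muln1 -sum_nat_const_nat [RHS](big_nat_widenl _ 0) //.
by rewrite [RHS](big_nat_widen _ _ _ _ _ le_bn).
Qed.

Section Frame.

Variables (d : nat) (k n : 'I_d -> nat).
Implicit Types (p q : entry_index k) (x : entry_index n) (M : matrix01 n).
Implicit Type P : matrix01 k.

(** The cells of the large matrix that can be the image of [p]. *)
Definition core p : {pred entry_index n} :=
  family (fun i => [pred j : 'I_(n i) | p i <= j < n i + p i + 1 - k i]).

Definition frame p : matrix01 n := [ffun x => x \notin core p].

Lemma core_itv p x i :
  x \in core p -> p i <= x i < n i + p i + 1 - k i.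
Proof. by move=> /familyP/(_ i). Qed.

Lemma increasing_in_core p (f : selection k n) :
  increasing f -> [ffun i => f i (p i)] \in core p.
Proof.
move=> /forallP f_incr; apply/familyP=> i; rewrite !ffunE inE.
have fi_incr (a b : 'I_(k i)) : a < b -> f i a < f i b.
  by move: (f_incr i) => /forallP/(_ a)/forallP/(_ b)/implyP.
have := increasing_range fi_incr (p i).
lia.
Qed.

Lemma card_core p : #|core p| = \prod_(i < d) (n i + 1 - k i).
Proof.
rewrite card_family foldrE big_map big_enum /=; apply: eq_bigr => i _.
have lt_pk := ltn_ord (p i).
rewrite card_ord_itv; lia.
Qed.

Lemma ones_frame p :
  ones (frame p) = \prod_(i < d) n i - \prod_(i < d) (n i + 1 - k i).
Proof.
have card_index : #|entry_index n| = \prod_(i < d) n i.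
  rewrite card_dep_ffun foldrE big_map big_enum /=.
  by under eq_bigr do rewrite card_ord.
rewrite -card_index -(card_core p) -(cardC (core p)) addKn.
by apply: eq_card => x; rewrite !inE ffunE.
Qed.

(** Sends slice [p i] to [x i], and the slices before and after it to the
    extreme positions, where they miss [core p].  When [x] is in
    the core these positions are below [n i], and [insubd] never returns its
    default value. *)
Definition spread p x : selection k n :=
  [ffun i => [ffun a : 'I_(k i) =>
    if a == p i then x i
    else insubd (x i) (if a < p i then a : nat else n i + a - k i)]].

Lemma spreadE p x i (a : 'I_(k i)) : x \in core p ->
  spread p x i a = (if a == p i then x i : nat
                    else if a < p i then a : nat else n i + a - k i) :> nat.
Proof.
move=> /(core_itv i) xi_core; rewrite !ffunE.
have := ltn_ord a; have := ltn_ord (x i); have := ltn_ord (p i).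
case: eqP => // _ lt_pk lt_xn lt_ak; rewrite val_insubd.
case: (ltnP a (p i)) => [lt_ap|le_pa]; rewrite ifT //; lia.
Qed.

Lemma spread_increasing p x : x \in core p -> increasing (spread p x).
Proof.
move=> x_core; apply/'forall_forallP=> i a; apply/forallP=> b.
apply/implyP=> lt_ab; rewrite !spreadE // -!val_eqE /=.
have := core_itv i x_core.
have := ltn_ord a; have := ltn_ord b; have := ltn_ord (p i).
by case: (ltngtP a (p i)); case: (ltngtP b (p i)); lia.
Qed.

Lemma spread_notin_core p x q : x \in core p -> q != p ->
  [ffun i => spread p x i (q i)] \notin core p.
Proof.
move=> x_core; apply: contra => q_core.
apply/eqP/ffunP=> i; apply/eqP; apply: contraT => neq_qp.
have := core_itv i q_core; rewrite ffunE spreadE // (negPf neq_qp).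
move: neq_qp; rewrite -val_eqE /=.
have := core_itv i x_core.
by have := ltn_ord (q i); case: (ltngtP (q i) (p i)) => //; lia.
Qed.

(** Only the value of [P] at [p] matters: [spread] puts all its other entries
    on the frame, whether they are ones or not. *)
Lemma frame_saturated p P : P p -> saturated P (frame p).
Proof.
move=> Pp; apply/andP; split.
  apply/existsP=> -[f /andP[f_incr /forallP/(_ p)]].
  by rewrite Pp !ffunE increasing_in_core.
apply/forallP=> x; rewrite ffunE negbK; apply/implyP=> x_core.
apply/existsP; exists (spread p x); rewrite spread_increasing //=.
apply/forallP=> q; apply/implyP=> _; rewrite !ffunE.
have [->|neq_qp] := eqVneq q p; last by rewrite spread_notin_core ?orbT.
by apply/orP; left; apply/eqP/ffunP=> i; rewrite !ffunE eqxx.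
Qed.

Definition single p : matrix01 k := [ffun q => q == p].

(** Conversely to [increasing_in_core], every cell [x] of the core is the image
    of [p] under some selection, for instance [spread p x]. *)
Lemma contains_single p M :
  contains M (single p) = [exists x in core p, M x].
Proof.
apply/existsP/exists_inP => [[f /andP[f_incr /forallP/(_ p)]]|[x x_core Mx]].
  rewrite !ffunE eqxx /= => Mfp.
  by exists [ffun i => f i (p i)]; first exact: increasing_in_core.
exists (spread p x); rewrite spread_increasing //=.
apply/forallP=> q; rewrite !ffunE; apply/implyP=> /eqP->.
by rewrite (_ : [ffun _ => _] = x) //; apply/ffunP=> i; rewrite !ffunE eqxx.
Qed.

(** A zero off the core could be switched on without creating a copy, since the
    image of [p] would still have to be an old one of the core. *)
Lemma saturated_single_frame p M : saturated (single p) M -> M = frame p.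
Proof.
rewrite /saturated contains_single => /andP[avoidM /forallP satM].
have coreM x : x \in core p -> ~~ M x.
  by move=> x_core; apply: contra avoidM => Mx; apply/exists_inP; exists x.
apply/ffunP=> x; rewrite ffunE; have [/coreM/negPf//|x_out] := boolP (x \in _).
apply: contraT => nMx; have := implyP (satM x) nMx.
rewrite contains_single => /exists_inP[y y_core]; rewrite ffunE.
rewrite (negPf (coreM y y_core)) orbF => /eqP eq_yx.
by rewrite -eq_yx y_core in x_out.
Qed.

End Frame.

Theorem theorem6p5 (d : nat) (k n : 'I_d -> nat)
  (d_ge1 : 1 <= d)
  (k_gt0 : forall i, 0 < k i) (n_gt0 : forall i, 0 < n i)
  (n_ge : forall i, k i - 1 <= n i) :
  let N := \prod_(i < d) n i - \prod_(i < d) (n i + 1 - k i) in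
  (exists2 P : matrix01 k, nonzero P & sat n P = N) /\
  (forall P : matrix01 k, nonzero P -> sat n P <= N).
Proof.
move=> N; split=> [|P /existsP[p Pp]]; last first.
  by rewrite /N -(ones_frame n p) sat_le // frame_saturated.
pose p : entry_index k := [ffun i => Ordinal (k_gt0 i)].
have nz : nonzero (single p) by apply/existsP; exists p; rewrite ffunE.
exists (single p) => //; have [M satM <-] := sat_attained n nz.
by rewrite (saturated_single_frame satM) ones_frame.
Qed.
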